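(* Let $n,p$ be positive integers and let $\mathcal{A}$ be the algebra of all $S_n$-invariant matrices in $\mathbb{C}^{[p]^n\times[p]^n}$. For each partition $\lambda\vdash n$ with at most $p$ parts, let $m_\lambda:=|\mathcal{T}_{\lambda,p}|$, and let $e_t$ ($t\in\mathcal{T}_{\lambda,p}$) and $R_\lambda$ be as defined in the context. Then the map $$\psi:\mathcal{A}\to\bigoplus_{\lambda}\mathbb{C}^{m_\lambda\times m_\lambda},\qquad A\mapsto\bigoplus_{\lambda}R_\lambda^{\mathsf T}\,M_\lambda(A)\,R_\lambda,$$ where $\lambda$ runs over all partitions of $n$ into at most $p$ parts and $M_\lambda(A)$ is the matrix with rows and columns indexed by $\mathcal{T}_{\lambda,p}$ whose entry in row $t$ and column $s$ is $\langle Ae_s,e_t\rangle$, is an isomorphism of $\ast$-algebras (a linear bijection with $\psi(AB)=\psi(A)\psi(B)$ and $\psi(A^* )=\psi(A)^*$ for all $A,B\in\mathcal{A}$).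
   Context: Notation: $[p]=\{1,\ldots,p\}$, and $[p]^n$ is the set of words of length $n$ over $[p]$. $S_n$ acts on $[p]^n$ by $(\sigma a)_i=a_{\sigma^{-1}(i)}$, and on matrices $M\in\mathbb{C}^{[p]^n\times[p]^n}$ by $(\sigma M)_{a,b}=M_{\sigma^{-1}a,\sigma^{-1}b}$; $\mathcal{A}=\{A\in\mathbb{C}^{[p]^n\times[p]^n}\mid \sigma A=A\text{ for all }\sigma\in S_n\}$. Put $V=\mathbb{C}^{[p]^n}$ with standard basis vectors $\chi^a$ ($a\in[p]^n$) and standard inner product $\langle x,y\rangle=y^*x$. Here $A^*$ denotes the conjugate transpose. A partition $\lambda\vdash n$ is a sequence of nonnegative integers $\lambda_1\ge\cdots\ge\lambda_n$ with sum $n$; it has at most $p$ parts if at most $p$ of the $\lambda_i$ are nonzero. Its Ferrers diagram has $\lambda_i$ boxes in row $i$ (left-justified); the boxes are numbered $1,\ldots,n$ in lexicographic order of position $(i,j)$, i.e. the box in row $i$ and column $j$ has number $\lambda_1+\cdots+\lambda_{i-1}+j$. A tableau $t$ of shape $\lambda$ is a filling of the boxes with entries from $[p]$; it is identified with the word $(t(1),\ldots,t(n))\in[p]^n$, where $t(k)$ is the entry of box $k$, and $(\sigma t)(k)=t(\sigma^{-1}(k))$ for $\sigma\in S_n$. A tableau is semistandard if its entries are (strictly) increasing down each column and non-decreasing along each row; $\mathcal{T}_{\lambda,p}$ denotes the set of semistandard tableaux of shape $\lambda$ with entries in $[p]$. $C_\lambda\le S_n$ is the group of permutations of the boxes preserving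 each column, $\mathrm{Row}_\lambda\le S_n$ the group of those preserving each row; $t\sim t'$ means $t'=\pi t$ for some $\pi\in \mathrm{Row}_\lambda$. For a tableau $t$ of shape $\lambda$, $$e_t:=\sum_{\sigma\in C_\lambda}\mathrm{sgn}(\sigma)\sum_{t'\sim t}\chi^{\sigma t'}\in V.$$ Let $B=(e_t)_{t\in\mathcal{T}_{\lambda,p}}$ be the matrix with the $e_t$ as columns (these are linearly independent), let $G_\lambda:=B^{\mathsf T}B$ be their Gram matrix, and let $R_\lambda$ be the real (lower triangular) matrix in a Cholesky decomposition $(G_\lambda)^{-1}=R_\lambda R_\lambda^{\mathsf T}$. *)

(* Defs.v *)
From HB Require Import structures.
From mathcomp Require Import all_boot all_order all_algebra all_fingroup.

Set Implicit Arguments.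
Unset Strict Implicit.
Unset Printing Implicit Defensive.

Import Order.TTheory GRing.Theory Num.Theory.

Local Open Scope ring_scope.
Local Open Scope sesquilinear_scope.

(* The alphabet {1, ..., p} and the positions {1, ..., n} are shifted to
   'I_p = {0, ..., p - 1} and 'I_n = {0, ..., n - 1}. *)
Definition word (n p : nat) := {ffun 'I_n -> 'I_p}.

HB.instance Definition _ n p := Finite.on (word n p).

Section Words.

Variables n p : nat.

Definition word_act (s : 'S_n) (a : word n p) : word n p :=
  [ffun i => a ((s^-1)%g i)].

(* The coordinate of a word a is enum_rank a : 'I_#|word n p|. *)
Definition mx_act (C : Type) (s : 'S_n) (M : 'M[C]_#|word n p|) :
    'M[C]_#|word n p| :=
  \matrix_(i, j) M (enum_rank (word_act (s^-1)%g (enum_val i)))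
                   (enum_rank (word_act (s^-1)%g (enum_val j))).

Lemma word_act_inj (s : 'S_n) : injective (word_act s).
Proof.
move=> a b /ffunP eq_ab; apply/ffunP => i.
by have := eq_ab (s i); rewrite !ffunE permK.
Qed.

End Words.

Section InvariantAlgebra.

Variables (C : numClosedFieldType) (n p : nat).
Local Notation MW := 'M[C]_#|word n p|.

Definition Sn_invariant : {pred MW} :=
  [pred A : MW | [forall s : 'S_n, mx_act s A == A]].

Lemma Sn_invariantP (A : MW) :
  reflect (forall s : 'S_n, mx_act s A = A) (A \in Sn_invariant).
Proof.
by apply: (iffP forallP) => invA s; [exact/eqP/invA | rewrite invA].
Qed.

Fact Sn_invariant_submod : submod_closed Sn_invariant.
Proof.
split; first by apply/Sn_invariantP => s; apply/matrixP => i j; rewrite !mxE.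
move=> c A B /Sn_invariantP invA /Sn_invariantP invB.
apply/Sn_invariantP => s; apply/matrixP => i j.
by rewrite -[in RHS](invA s) -[in RHS](invB s) !mxE.
Qed.

Fact Sn_invariant_mul : mulr_closed Sn_invariant.
Proof.
have act_inj (s : 'S_n) : injective
    (fun k : 'I_#|word n p| => enum_rank (word_act (s^-1)%g (enum_val k))).
  by move=> i j /enum_rank_inj /word_act_inj /enum_val_inj.
split.
  apply/Sn_invariantP => s; apply/matrixP => i j.
  by rewrite !mxE (inj_eq (act_inj s)).
move=> A B /Sn_invariantP invA /Sn_invariantP invB.
apply/Sn_invariantP => s; apply/matrixP => i j.
rewrite !mxE (reindex_inj (act_inj s)) /=.
by apply: eq_bigr => k _; rewrite -[in RHS](invA s) -[in RHS](invB s) !mxE.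
Qed.

HB.instance Definition _ :=
  GRing.isSubmodClosed.Build C MW Sn_invariant Sn_invariant_submod.
HB.instance Definition _ :=
  GRing.isMulClosed.Build MW Sn_invariant Sn_invariant_mul.

Record invariant_alg : predArgType := InvariantAlg {
  inv_mx :> MW;
  inv_mxP : inv_mx \in Sn_invariant }.

HB.instance Definition _ := [isSub for inv_mx].
HB.instance Definition _ := [Choice of invariant_alg by <:].
HB.instance Definition _ := [SubChoice_isSubZmodule of invariant_alg by <:].
HB.instance Definition _ := [SubZmodule_isSubLmodule of invariant_alg by <:].
HB.instance Definition _ :=
  GRing.SubZmodule_isSubPzRing.Build MW Sn_invariant invariant_alg
    (subringClosedP _).

Fact Sn_invariant_adj (A : invariant_alg) : (A : MW) ^t* \in Sn_invariant.
Proof.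
apply/Sn_invariantP => s; apply/matrixP => i j.
by rewrite -[in RHS](Sn_invariantP _ (inv_mxP A) s) !mxE.
Qed.

Definition inv_adj (A : invariant_alg) : invariant_alg :=
  InvariantAlg (Sn_invariant_adj A).

End InvariantAlgebra.

Section DirectSum.

Variables (C : numClosedFieldType) (I : finType) (m : I -> nat).

(* The direct sum over i of the full matrix algebras of size m i, with
   componentwise operations. *)
Definition mx_sum := {dffun forall i : I, 'M[C]_(m i)}.

HB.instance Definition _ := Choice.on mx_sum.

Implicit Types X Y : mx_sum.

Definition mx_sum_zero : mx_sum := [ffun i => 0 : 'M[C]_(m i)].
Definition mx_sum_opp X : mx_sum := [ffun i => - X i : 'M[C]_(m i)].
Definition mx_sum_add X Y : mx_sum := [ffun i => X i + Y i : 'M[C]_(m i)].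
Definition mx_sum_scale (c : C) X : mx_sum := [ffun i => c *: X i : 'M[C]_(m i)].
Definition mx_sum_one : mx_sum := [ffun i => 1%:M : 'M[C]_(m i)].
Definition mx_sum_mul X Y : mx_sum := [ffun i => X i *m Y i : 'M[C]_(m i)].
Definition mx_sum_adj X : mx_sum := [ffun i => (X i) ^t* : 'M[C]_(m i)].

Fact mx_sum_addA : associative mx_sum_add.
Proof. by move=> X Y Z; apply/ffunP => i; rewrite !ffunE addrA. Qed.
Fact mx_sum_addC : commutative mx_sum_add.
Proof. by move=> X Y; apply/ffunP => i; rewrite !ffunE addrC. Qed.
Fact mx_sum_add0 : left_id mx_sum_zero mx_sum_add.
Proof. by move=> X; apply/ffunP => i; rewrite !ffunE add0r. Qed.
Fact mx_sum_addN : left_inverse mx_sum_zero mx_sum_opp mx_sum_add.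
Proof. by move=> X; apply/ffunP => i; rewrite !ffunE addNr. Qed.

HB.instance Definition _ := GRing.isZmodule.Build mx_sum
  mx_sum_addA mx_sum_addC mx_sum_add0 mx_sum_addN.

Fact mx_sum_scaleA c d X :
  mx_sum_scale c (mx_sum_scale d X) = mx_sum_scale (c * d) X.
Proof. by apply/ffunP => i; rewrite !ffunE scalerA. Qed.
Fact mx_sum_scale1 : left_id 1 mx_sum_scale.
Proof. by move=> X; apply/ffunP => i; rewrite !ffunE scale1r. Qed.
Fact mx_sum_scaleDr : right_distributive mx_sum_scale +%R.
Proof. by move=> c X Y; apply/ffunP => i; rewrite !ffunE scalerDr. Qed.
Fact mx_sum_scaleDl X : {morph mx_sum_scale^~ X : c d / c + d}.
Proof. by move=> c d; apply/ffunP => i; rewrite !ffunE scalerDl. Qed.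

HB.instance Definition _ := GRing.Zmodule_isLmodule.Build C mx_sum
  mx_sum_scaleA mx_sum_scale1 mx_sum_scaleDr mx_sum_scaleDl.

Fact mx_sum_mulA : associative mx_sum_mul.
Proof. by move=> X Y Z; apply/ffunP => i; rewrite !ffunE mulmxA. Qed.
Fact mx_sum_mul1x : left_id mx_sum_one mx_sum_mul.
Proof. by move=> X; apply/ffunP => i; rewrite !ffunE mul1mx. Qed.
Fact mx_sum_mulx1 : right_id mx_sum_one mx_sum_mul.
Proof. by move=> X; apply/ffunP => i; rewrite !ffunE mulmx1. Qed.
Fact mx_sum_mulDl : left_distributive mx_sum_mul +%R.
Proof. by move=> X Y Z; apply/ffunP => i; rewrite !ffunE mulmxDl. Qed.
Fact mx_sum_mulDr : right_distributive mx_sum_mul +%R.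
Proof. by move=> X Y Z; apply/ffunP => i; rewrite !ffunE mulmxDr. Qed.

HB.instance Definition _ := GRing.Zmodule_isPzRing.Build mx_sum
  mx_sum_mulA mx_sum_mul1x mx_sum_mulx1 mx_sum_mulDl mx_sum_mulDr.

End DirectSum.

Section Tableaux.

Variables n p : nat.

(* The parts of a partition of n are at most n, hence the type 'I_n.+1. *)
Definition is_partition (la : n.-tuple 'I_n.+1) : bool :=
  [&& sorted geq (map val la), sumn (map val la) == n
    & (count (fun k => k != 0) (map val la) <= p)%N].

Definition partition_of := {la : n.-tuple 'I_n.+1 | is_partition la}.

HB.instance Definition _ := Finite.on partition_of.

Variable la : partition_of.

Definition parts : seq nat := map val (val la).

(* Row i holds the boxes numbered la_0 + ... + la_(i-1) + j for j < la_i: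
   the item of a flattened sequence of shape parts that has index k lies in
   row reshape_index parts k, at column reshape_offset parts k. *)
Definition box_row (k : 'I_n) : nat := reshape_index parts k.
Definition box_col (k : 'I_n) : nat := reshape_offset parts k.

Definition col_group : {set 'S_n} :=
  [set s : 'S_n | [forall k, box_col (s k) == box_col k]].
Definition row_group : {set 'S_n} :=
  [set s : 'S_n | [forall k, box_row (s k) == box_row k]].

(* A tableau of shape la is identified with the word of its entries, read in
   the order of the box numbers. *)
Definition semistandard (t : word n p) : bool :=
  [forall k, forall l,
     ((box_col k == box_col l) && (box_row k < box_row l)%N ==> (t k < t l)%N)
     && ((box_row k == box_row l) && (box_col k < box_col l)%N
         ==> (t k <= t l)%N)].

Definition ssyt : {set word n p} := [set t | semistandard t].

Definition row_equiv (t t' : word n p) : bool :=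
  [exists s in row_group, t' == word_act s t].

Variable C : numClosedFieldType.

Definition chi (a : word n p) : 'cV[C]_#|word n p| := delta_mx (enum_rank a) 0.

Definition tab_vec (t : word n p) : 'cV[C]_#|word n p| :=
  \sum_(s in col_group)
    (-1) ^+ s *: \sum_(t' | row_equiv t t') chi (word_act s t').

Definition inner N (x y : 'cV[C]_N) : C := (y ^t* *m x) 0 0.

(* The index i : 'I_#|ssyt| stands for the tableau enum_val i. *)
Definition tab_basis : 'M[C]_(#|word n p|, #|ssyt|) :=
  \matrix_(k, i) tab_vec (enum_val i) k 0.

Definition tab_gram : 'M[C]_#|ssyt| := tab_basis^T *m tab_basis.

Definition tab_form (A : 'M[C]_#|word n p|) : 'M[C]_#|ssyt| :=
  \matrix_(i, j) inner (A *m tab_vec (enum_val j)) (tab_vec (enum_val i)).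

End Tableaux.

(* H = L L^T with L real and lower triangular. Rows and columns stand for
   objects that carry no preferred order, so triangularity is required for some
   simultaneous reordering of the rows and columns. *)
Definition cholesky_factor (C : numClosedFieldType) m (H L : 'M[C]_m) : Prop :=
  [/\ L \is a mxOver Num.real,
      exists s : 'S_m, is_trig_mx (mxsub s s L)
    & H = L *m L^T].

Definition block_diag_map (C : numClosedFieldType) (n p : nat)
    (L : forall la : partition_of n p, 'M[C]_#|ssyt la|)
    (A : invariant_alg C n p) :
    mx_sum C (fun la : partition_of n p => #|ssyt la|) :=
  [ffun la : partition_of n p =>
     (L la)^T *m tab_form la (A : 'M[C]_#|word n p|) *m L la : 'M[C]_#|ssyt la|].

(* Main.v *)
From HB Require Import structures.
Require Import Defs.
From mathcomp Require Import all_boot all_order all_algebra all_fingroup.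
From mathcomp Require Import reals complex.
From mathcomp Require Import zify.

Set Implicit Arguments.
Unset Strict Implicit.
Unset Printing Implicit Defensive.

Import Order.TTheory GRing.Theory Num.Theory.

(** Write [V] for the space spanned by the words, on which the symmetric group
    acts by permuting positions, and [B la] for the matrix whose columns are the
    vectors of the semistandard tableaux of shape [la], with Gram matrix
    [G la = (B la)^T *m B la].  The Cholesky condition makes the columns of
    [B la *m L la] orthonormal, and [block_diag_map] compresses an invariant
    matrix to their span.  So it respects adjoints, it is multiplicative as soon
    as invariant matrices preserve the span, and what remains is bijectivity.

    The key is to produce all invariant matrices explicitly: for every
    coordinate matrix [Y] the sum [tab_inv Y] of the conjugates of
    [B la *m Y *m (B la)^T] under the group is invariant.  It multiplies [B mu]
    to zero if [mu] differs from [la], and [B la] to [B la *m Y *m K] for an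
    invertible [K] that does not depend on [Y] ([tab_inv_off_diag],
    [tab_inv_diag]).  The columns of [B la] are of the form [young_sym la *m x],
    so the first fact and the existence of [K] follow from the relations between
    Young symmetrizers: [young_sym mu *m act_mx h *m young_sym la] vanishes for
    different shapes and is a multiple of [young_sym la] for equal ones.  These
    rest on the combinatorial lemma [rows_to_distinct_columns].  Invertibility of
    [K] follows from positivity of the Gram form and the linear independence of
    the tableau vectors, [tab_basis_inj], whose reason is that their coefficients
    on semistandard words are unitriangular for a suitable weight.

    Hence the matrices [tab_inv Y], for all shapes together, form a space of
    dimension equal to the number of pairs of semistandard tableaux of the same
    shape.  Conversely, the value of an invariant matrix at a pair of words
    depends only on the orbit of the pair, and the Robinson-Schensted-Knuth
    correspondence injects the orbits into those pairs of tableaux ([rsk_ex],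
    [rsk_inj]).  So the matrices [tab_inv Y] exhaust the invariant algebra
    ([tab_inv_span]).  They preserve the spans, and [block_diag_map] maps them
    bijectively, as [K] and [L la] are invertible. *)

(** * Boxes of a Ferrers diagram *)

(** If [f] separates [R]-related points, exactly one of two distinct such points has
    the smaller value, so both sums count the unordered pairs of distinct related
    points. *)
Lemma sum_rank_in_class (T : finType) (R : rel T) (f g : T -> nat) :
  symmetric R ->
  (forall x y, R x y -> f x = f y -> x = y) ->
  (forall x y, R x y -> g x = g y -> x = y) ->
  (\sum_x #|[pred y | R x y && (f y < f x)]| =
   \sum_x #|[pred y | R x y && (g y < g x)]|).
Proof.
move=> Rsym f_sep g_sep; apply: double_inj.
have main (h : T -> nat) : (forall x y, R x y -> h x = h y -> x = y) ->
  (\sum_x #|[pred y | R x y && (h y < h x)]|).*2 =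
  (\sum_x \sum_y (R x y && (x != y))).
  move=> h_sep; rewrite -addnn.
  under eq_bigr => x _.
    rewrite -sum1_card big_mkcond /=; under eq_bigr => y _ do rewrite inE.
    over.
  rewrite {2}exchange_big -big_split /=; apply: eq_bigr => x _.
  rewrite -big_split /=; apply: eq_bigr => y _; rewrite (Rsym y).
  have [Rxy|] //= := boolP (R x y); have [<-|neq_xy] := eqVneq x y; first by rewrite ltnn.
by case: ltngtP => // /esym/(h_sep _ _ Rxy)/eqP; rewrite (negbTE neq_xy).
by rewrite !main.
Qed.

Lemma card_inj_lt (T : finType) (A : {pred T}) (f : T -> nat) m :
  {in A &, injective f} -> (forall x, x \in A -> f x < m) -> #|A| <= m.
Proof.
move=> f_inj f_lt; have uniq_f : uniq [seq f x | x <- enum A].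
  by rewrite map_inj_in_uniq ?enum_uniq // => x y; rewrite !mem_enum; apply: f_inj.
rewrite cardE -(size_map f) -[leqRHS](size_iota 0); apply: uniq_leq_size => // z /mapP[x].
by rewrite mem_enum => /f_lt lt_x ->; rewrite mem_iota.
Qed.

Section Boxes.

Variables n p : nat.
Implicit Types la mu : partition_of n p.

Lemma size_parts la : size (parts la) = n.
Proof. by rewrite /parts size_map size_tuple. Qed.

Lemma sumn_parts la : sumn (parts la) = n.
Proof. by case/and3P: (valP la) => _ /eqP. Qed.

Lemma parts_noninc la i j :
  i <= j -> nth 0 (parts la) j <= nth 0 (parts la) i.
Proof.
case/and3P: (valP la) => la_sorted _ _; rewrite leq_eqVlt => /predU1P[-> //|lt_ij].
have [le_n_j|lt_j_n] := leqP n j; first by rewrite nth_default ?size_parts.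
have geq_trans : transitive geq by move=> x y z /= yx xz; apply: leq_trans xz yx.
apply: (sorted_ltn_nth geq_trans 0 la_sorted) (lt_ij).
  by rewrite inE -/(parts la) size_parts; apply: ltn_trans lt_ij lt_j_n.
by rewrite inE -/(parts la) size_parts.
Qed.

Lemma box_col_lt la k : box_col la k < nth 0 (parts la) (box_row la k).
Proof. by apply: reshape_offsetP; rewrite sumn_parts. Qed.

Lemma box_inj la k l :
  box_row la k = box_row la l -> box_col la k = box_col la l -> k = l.
Proof.
rewrite /box_row /box_col => eq_r eq_c; apply: val_inj.
by rewrite /= -(reshape_indexK (parts la) k) eq_r eq_c reshape_indexK.
Qed.

Lemma box_ex la r c : c < nth 0 (parts la) r ->
  exists2 k, box_row la k = r & box_col la k = c.
Proof.
move=> lt_c; have lt_n := flatten_indexP lt_c; rewrite sumn_parts in lt_n.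
exists (Ordinal lt_n); rewrite /box_row /box_col /=.
  by rewrite flatten_indexKl.
by rewrite flatten_indexKr.
Qed.

Lemma box_above la k r : r <= box_row la k ->
  exists2 l, box_row la l = r & box_col la l = box_col la k.
Proof.
by move=> le_r; apply: box_ex; apply: leq_trans (box_col_lt la k) (parts_noninc _ le_r).
Qed.

Lemma card_row la r : #|[pred k | box_row la k == r]| = nth 0 (parts la) r.
Proof.
rewrite -[RHS]card_ord.
have [f fr fc] := fin_all_exists2 (fun c : 'I_(nth 0 (parts la) r) => box_ex (ltn_ord c)).
have f_inj : injective f by move=> c d /(congr1 (box_col la)); rewrite !fc => /val_inj.
rewrite -(card_imset _ f_inj); apply: eq_card => k; rewrite inE.
apply/eqP/imsetP => [row_k|[c _ ->] //].
have := box_col_lt la k; rewrite row_k => lt_c.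
by exists (Ordinal lt_c) => //; apply: (@box_inj la); rewrite ?fr ?fc.
Qed.

Lemma eq_partition la mu :
  (forall r, nth 0 (parts la) r = nth 0 (parts mu) r) -> la = mu.
Proof.
move=> eq_nth; apply: val_inj; apply: val_inj; apply: (inj_map val_inj).
by apply: (@eq_from_nth _ 0) => [|r _]; rewrite ?size_map ?size_tuple //; apply: eq_nth.
Qed.

Lemma card_above la k :
  #|[pred l | (box_col la k == box_col la l) && (box_row la l < box_row la k)]| =
  box_row la k.
Proof.
apply/eqP; rewrite eqn_leq; apply/andP; split.
  apply: (card_inj_lt (f := box_row la)) => [l m|l /andP[] //].
  move=> /andP[/eqP eq_l _] /andP[/eqP eq_m _] eq_lm.
  by apply: (box_inj eq_lm); rewrite -eq_l.
have [f fr fc] :=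
  fin_all_exists2 (fun r : 'I_(box_row la k) => box_above (ltnW (ltn_ord r))).
have f_inj : injective f by move=> r s /(congr1 (box_row la)); rewrite !fr => /val_inj.
rewrite -{1}(card_ord (box_row la k)) -(card_imset _ f_inj).
apply/subset_leq_card/subsetP => _ /imsetP[r _ ->].
by rewrite inE fc fr eqxx ltn_ord.
Qed.

(** The statistic usually denoted n(la). *)
Definition leg_sum la := \sum_k box_row la k.

(** The key combinatorial fact about Young symmetrizers: a permutation that
    spreads every row of [la] over distinct columns of [mu] pushes boxes
    upwards on average.  In each column of [mu] the rows of the preimages are
    distinct, so each of them is at least its rank among them, whereas the rows
    of the boxes of the column itself are exactly these ranks.  If the sums
    agree, every row equals its rank, so that moving each box of [la] within its
    row to the column where the permutation sends it is a bijection onto [mu]. *)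
Lemma rows_to_distinct_columns la mu (h : 'S_n) :
  (forall k l, box_row la k = box_row la l ->
     box_col mu (h k) = box_col mu (h l) -> k = l) ->
  leg_sum mu <= leg_sum la /\
  (leg_sum mu = leg_sum la -> la = mu /\
   exists2 rho, rho \in row_group la & (rho^-1 * h)%g \in col_group mu).
Proof.
move=> h_sep; pose R k l := box_col mu (h k) == box_col mu (h l).
pose rank (f : 'I_n -> nat) k := #|[pred l | R k l && (f l < f k)]|.
have Rsym : symmetric R by move=> k l; apply: eq_sym.
have la_sep k l : R k l -> box_row la k = box_row la l -> k = l.
  by move=> /eqP eq_c eq_r; apply: h_sep.
have mu_sep k l : R k l -> box_row mu (h k) = box_row mu (h l) -> k = l.
  by move=> /eqP eq_c eq_r; apply/(@perm_inj _ h)/(box_inj eq_r).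
have mu_rank k : rank (box_row mu \o h) k = box_row mu (h k).
  rewrite -[RHS]card_above /rank -!sum1_card [RHS](reindex_inj (@perm_inj _ h)).
  by apply: eq_bigl => l; rewrite !inE.
have la_rank k : rank (box_row la) k <= box_row la k.
  apply: (card_inj_lt (f := box_row la)) => [l m|l /andP[] //].
  move=> /andP[/eqP eq_l _] /andP[/eqP eq_m _]; apply: la_sep.
  by rewrite /R -eq_l eq_m.
have sum_mu : leg_sum mu = \sum_k rank (box_row la) k.
  rewrite (sum_rank_in_class Rsym la_sep mu_sep) /leg_sum.
  rewrite (reindex_inj (@perm_inj _ h)) /=.
  by apply: eq_bigr => k _; rewrite -[LHS]mu_rank.
split=> [|eq_sum]; first by rewrite sum_mu; apply: leq_sum.
have {}la_rank k : rank (box_row la) k = box_row la k.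
  have le_sum := leqif_sum (fun (k : 'I_n) (_ : true) => leqif_eq (la_rank k)).
  have [_] := le_sum; rewrite -sum_mu eq_sum eqxx.
  by move/esym/forallP/(_ k)/eqP.
have move_ex k :
    exists2 l, box_row mu l = box_row la k & box_col mu l = box_col mu (h k).
  (* Otherwise the whole column lies above the row of k, but the number of its
     boxes exceeds the rank of k, which is that row. *)
  have [l Rkl le_l] : exists2 l, R k l & box_row la k <= box_row mu (h l).
    apply/exists_inP; apply: contraT => /exists_inPn no_l.
    suff: #|[pred l | R k l]| <= rank (box_row la) k.
      rewrite leqNgt => /negP[]; apply/proper_card/properP; split.
        by apply/subsetP => l /andP[].
      by exists k; rewrite !inE ?ltnn ?andbF // /R.
    rewrite la_rank; apply: (card_inj_lt (f := box_row mu \o h)) => [l m|l Rkl].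
      move=> /eqP eq_l /eqP eq_m; apply: mu_sep.
      by rewrite /R -eq_l eq_m.
    by rewrite ltnNge; apply: no_l.
  have [m eq_r eq_c] := box_above le_l; exists m => //.
  by rewrite eq_c -(eqP Rkl).
have [rho rho_row rho_col] := fin_all_exists2 move_ex.
have rho_inj : injective rho.
  move=> k l eq_rho; apply: h_sep; first by rewrite -!rho_row eq_rho.
  by rewrite -!rho_col eq_rho.
have eq_la : la = mu.
  apply: eq_partition => r; rewrite -!card_row -!sum1_card.
  rewrite [RHS](reindex_inj rho_inj) /=.
  by apply: eq_bigl => k; rewrite !inE rho_row.
split=> //; exists (perm rho_inj).
  by rewrite inE; apply/forallP => k; rewrite permE eq_la rho_row eq_la.
rewrite inE; apply/forallP => k; rewrite permM -rho_col -(permE rho_inj).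
by rewrite permKV.
Qed.

End Boxes.

(** * Growth diagrams and the Robinson-Schensted-Knuth correspondence *)

Section GrowthDiagrams.

Lemma sum_recr (F : nat -> nat) k :
  \sum_(r < k.+1) F r = \sum_(r < k) F r + F k.
Proof. exact: big_ord_recr. Qed.

Definition interlace (ka la : nat -> nat) :=
  forall r, ka r <= la r /\ la r.+1 <= ka r.

Lemma interlace_noninc ka la r s : interlace ka la -> r <= s -> ka s <= ka r.
Proof.
move=> lace /subnKC <-; elim: (s - r) => [|d IHd]; first by rewrite addn0.
apply: leq_trans IHd; rewrite addnS.
by have [[le1 _] [_ le2]] := (lace (r + d).+1, lace (r + d)); apply: leq_trans le1 le2.
Qed.

Lemma chain_mono (sh : nat -> nat -> nat) i j r :
  (forall i, interlace (sh i) (sh i.+1)) -> i <= j -> sh i r <= sh j r.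
Proof.
move=> lace /subnKC <-; elim: (j - i) => [|d IHd]; first by rewrite addn0.
by apply: leq_trans IHd _; rewrite addnS; case: (lace (i + d) r).
Qed.

(** Fomin's local rule in piecewise linear form.  In row [r.+1] the result exceeds
    the larger of [mu] and [nu] by as much as the smaller of them exceeds [ka] in
    row [r]; in row [0] it exceeds the larger one by [m].  So [mu], [nu] and the
    result determine [m] and [ka], which is what makes the correspondence
    injective. *)
Definition local_rule (m : nat) (ka mu nu : nat -> nat) : nat -> nat :=
  fun r => if r is r'.+1
           then maxn (mu r) (nu r) + minn (mu r') (nu r') - ka r'
           else m + maxn (mu 0) (nu 0).

Lemma local_rule_interlace m ka mu nu :
  interlace ka mu -> interlace ka nu ->
  interlace mu (local_rule m ka mu nu) /\ interlace nu (local_rule m ka mu nu).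
Proof.
move=> ka_mu ka_nu; split=> r; have := (ka_mu r, ka_nu r).
  case: r => [|r] /= [[? ?] [? ?]]; first lia.
  have [[? ?] [? ?]] := (ka_mu r, ka_nu r); lia.
case: r => [|r] /= [[? ?] [? ?]]; first lia.
have [[? ?] [? ?]] := (ka_mu r, ka_nu r); lia.
Qed.

Lemma local_rule_inj m m' ka ka' mu nu :
  interlace ka mu -> interlace ka nu -> interlace ka' mu -> interlace ka' nu ->
  local_rule m ka mu nu =1 local_rule m' ka' mu nu -> m = m' /\ ka =1 ka'.
Proof.
move=> ka_mu ka_nu ka'_mu ka'_nu eq_rule; split.
  by have /= /addIn := eq_rule 0.
move=> r; have /= := eq_rule r.+1.
have [[? ?] [? ?]] := (ka_mu r, ka_nu r).
have [[? ?] [? ?]] := (ka'_mu r, ka'_nu r); lia.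
Qed.

Lemma sum_local_rule m ka mu nu N :
  interlace ka mu -> interlace ka nu -> mu N = 0 ->
  \sum_(r < N.+1) local_rule m ka mu nu r + \sum_(r < N.+1) ka r =
  m + \sum_(r < N.+1) mu r + \sum_(r < N.+1) nu r.
Proof.
move=> ka_mu ka_nu mu_N; have ka_N : ka N = 0 by have [] := ka_mu N; lia.
have rule_sum k : \sum_(r < k.+1) local_rule m ka mu nu r + \sum_(r < k) ka r =
   m + \sum_(r < k.+1) maxn (mu r) (nu r) + \sum_(r < k) minn (mu r) (nu r).
  elim: k => [|k IHk]; first by rewrite !big_ord1 !big_ord0 /=; lia.
  rewrite (sum_recr (local_rule m ka mu nu)) (sum_recr ka).
  rewrite (sum_recr (fun r => maxn (mu r) (nu r))).
  rewrite (sum_recr (fun r => minn (mu r) (nu r))).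
  cbn beta; rewrite [local_rule _ _ _ _ k.+1]/=.
  have [[? ?] [? ?]] := (ka_mu k, ka_nu k); lia.
have max_min_sum k : \sum_(r < k) maxn (mu r) (nu r) + \sum_(r < k) minn (mu r) (nu r)
   = \sum_(r < k) mu r + \sum_(r < k) nu r.
  by rewrite -!big_split; apply: eq_bigr => r _; rewrite /= addnC addn_min_max.
have := rule_sum N; have := max_min_sum N.+1.
rewrite (sum_recr ka) (sum_recr (fun r => minn (mu r) (nu r))).
by cbn beta; rewrite mu_N ka_N; lia.
Qed.

Fixpoint growth (M : nat -> nat -> nat) i : nat -> nat -> nat :=
  if i is i'.+1 then
    fix growth_row j :=
      if j is j'.+1 then
        local_rule (M i' j') (growth M i' j') (growth M i' j'.+1) (growth_row j')
      else fun _ => 0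
  else fun _ _ => 0.

Lemma growth0r M i : growth M i 0 = fun _ => 0. Proof. by case: i. Qed.

Lemma growthSS M i j :
  growth M i.+1 j.+1 =
  local_rule (M i j) (growth M i j) (growth M i j.+1) (growth M i.+1 j).
Proof. by []. Qed.

Lemma growth_interlace M i j :
  interlace (growth M i j) (growth M i.+1 j) /\
  interlace (growth M i j) (growth M i j.+1).
Proof.
have step i' j' : interlace (growth M i' j') (growth M i' j'.+1) ->
    interlace (growth M i' j') (growth M i'.+1 j') ->
    interlace (growth M i' j'.+1) (growth M i'.+1 j'.+1) /\
    interlace (growth M i'.+1 j') (growth M i'.+1 j'.+1).
  by rewrite growthSS; apply: local_rule_interlace.
have vert i' : (forall j', interlace (growth M i' j') (growth M i' j'.+1)) ->
    forall j', interlace (growth M i' j') (growth M i'.+1 j').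
  move=> hor; elim=> [|j' IHj]; first by rewrite !growth0r.
  by have [] := step _ _ (hor j') IHj.
have hor : forall i' j', interlace (growth M i' j') (growth M i' j'.+1).
  elim=> [//|i' IHi] j'.
  by have [] := step _ _ (IHi j') (vert _ IHi j').
by split; [apply/vert/hor | apply: hor].
Qed.

Lemma growth_chainl M j i : interlace (growth M i j) (growth M i.+1 j).
Proof. by have [] := growth_interlace M i j. Qed.

Lemma growth_chainr M i j : interlace (growth M i j) (growth M i j.+1).
Proof. by have [] := growth_interlace M i j. Qed.

Lemma growth_eq0 M i j r : i <= r -> growth M i j r = 0.
Proof.
elim: i r => [//|i IHi] [//|r] le_ir.
have [_] := growth_chainl M j i r.
by rewrite IHi // leqn0 => /eqP.
Qed.

Lemma sum_growth M i j N : i <= N ->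
  \sum_(r < N.+1) growth M i j r = \sum_(i' < i) \sum_(j' < j) M i' j'.
Proof.
elim: i => [_|i IHi lt_iN]; first by rewrite big1 // big_ord0.
rewrite (sum_recr (fun i' => \sum_(j' < j) M i' j')) -{}IHi ?(ltnW lt_iN) //.
elim: j => [|j IHj].
  by rewrite !growth0r !big_ord0 addn0.
have mu_N := growth_eq0 M j.+1 (ltnW lt_iN).
have := sum_local_rule (M i j) (growth_chainr M i j) (growth_chainl M j i) mu_N.
rewrite -growthSS {}IHj (sum_recr (M i)); lia.
Qed.

(** Running the local rule backwards from the outer border recovers the whole
    diagram, and with it the matrix. *)
Lemma growth_inj M M' p :
  (forall i, i <= p -> growth M i p =1 growth M' i p) ->
  (forall j, j <= p -> growth M p j =1 growth M' p j) ->
  forall i j, i < p -> j < p -> M i j = M' i j.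
Proof.
move=> eq_r eq_b.
have step i j : growth M i.+1 j.+1 =1 growth M' i.+1 j.+1 ->
    growth M i j.+1 =1 growth M' i j.+1 -> growth M i.+1 j =1 growth M' i.+1 j ->
    M i j = M' i j /\ growth M i j =1 growth M' i j.
  move=> eq11 eq01 eq10; have [col_lace row_lace] := growth_interlace M i j.
  apply: (local_rule_inj (mu := growth M i j.+1) (nu := growth M i.+1 j)) => //.
  - by move=> r; rewrite !eq01; apply: growth_chainr.
  - by move=> r; rewrite !eq10; apply: growth_chainl.
  - move=> r; rewrite -growthSS eq11 growthSS /local_rule.
    by case: r => [|r]; rewrite !eq01 !eq10.
have all_eq a b i j : i + a = p -> j + b = p -> growth M i j =1 growth M' i j.
  elim: a b i j => [|a IHa] b i j.
    by rewrite addn0 => -> def_j; apply: eq_b; lia.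
  move=> def_i; elim: b j => [|b IHb] j.
    by rewrite addn0 => ->; apply: eq_r; lia.
  move=> def_j; have [] // := step i j; [apply: (IHa b) | apply: IHb | apply: (IHa b.+1)];
  lia.
move=> i j lt_i lt_j; have [] // := step i j.
- by apply: (all_eq (p - i.+1) (p - j.+1)); lia.
- by apply: (all_eq (p - i) (p - j.+1)); lia.
- by apply: (all_eq (p - i.+1) (p - j)); lia.
Qed.

End GrowthDiagrams.

Section WordPairs.

Variables n p : nat.
Implicit Types (la : partition_of n p) (a b t s : word n p).

Lemma partition_of_fun (f : nat -> nat) N :
  (forall i j, i <= j -> f j <= f i) -> (forall r, p <= r -> f r = 0) ->
  n <= N -> \sum_(r < N.+1) f r = n ->
  exists la, forall r, nth 0 (parts la) r = f r.
Proof.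
move=> f_noninc f_p le_nN sum_f.
(* f is nonincreasing: a nonzero value at r >= n is preceded by n others *)
have f_n r : n <= r -> f r = 0.
  move=> le_nr; apply/eqP; apply: contraT; rewrite -lt0n => f_gt0.
  suff: \sum_(i < n.+1) 1 <= \sum_(i < N.+1) f i.
    by rewrite sum_f sum_nat_const card_ord muln1 ltnn.
  rewrite (big_ord_widen N.+1 (fun _ => 1)) //.
  rewrite [leqRHS](bigID (fun i : 'I__ => i < n.+1)) /=.
  apply: leq_trans (leq_addr _ _); apply: leq_sum => i lt_in.
  by apply: leq_trans f_gt0 (f_noninc _ _ _); apply: leq_trans le_nr.
have f_le r : f r < n.+1.
  rewrite ltnS; have [le_nr|lt_rn] := leqP n r; first by rewrite f_n.
  have lt_rN : r < N.+1 by rewrite ltnS; apply: leq_trans le_nN; apply: ltnW.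
  by rewrite -sum_f (bigD1 (Ordinal lt_rN)) //= leq_addr.
pose la : n.-tuple 'I_n.+1 := [tuple Ordinal (f_le r) | r < n].
have def_la : map val la = map f (iota 0 n).
  by rewrite -val_enum_ord -!map_comp; apply: eq_map.
have nth_la r : nth 0 (map val la) r = f r.
  rewrite def_la; have [le_nr|lt_rn] := leqP n r.
    by rewrite f_n // nth_default // size_map size_iota.
  by rewrite (nth_map 0) ?size_iota // nth_iota.
have la_part : is_partition p la.
  apply/and3P; split.
  - apply/(sortedP 0) => i _; rewrite !nth_la; exact: f_noninc.
  - rewrite -[eqbRHS]sum_f def_la sumnE big_map -{1}[n]subn0 -/(index_iota 0 n) big_mkord.
    rewrite (big_ord_widen N.+1 f (ltnW _)) ?ltnS //; apply/eqP.
    rewrite [RHS](bigID (fun i : 'I__ => i < n)) /= [X in _ = _ + X]big1 ?addn0 //.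
    by move=> i; rewrite -leqNgt => /f_n.
  - rewrite def_la count_map -size_filter -[leqRHS](size_iota 0).
    apply: uniq_leq_size => [|r]; first by rewrite filter_uniq ?iota_uniq.
    rewrite mem_filter !mem_iota !add0n /= => /andP[f_r _].
    by rewrite ltnNge; apply: contra f_r => /f_p->.
by exists (Sub la la_part).
Qed.

(** A chain of interlacing partitions and a semistandard tableau are the same
    data: letter [v] fills the boxes of [sh v.+1] that lie outside [sh v]. *)
Definition records la t (sh : nat -> nat -> nat) :=
  forall i k, i <= p -> (t k < i) = (box_col la k < sh i (box_row la k)).

Lemma tableau_of_chain la (sh : nat -> nat -> nat) :
  (forall i, interlace (sh i) (sh i.+1)) -> (forall r, sh 0 r = 0) ->
  (forall r, sh p r = nth 0 (parts la) r) ->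
  exists2 t, t \in ssyt la & records la t sh.
Proof.
move=> lace sh0 shp.
have entry k : exists v : 'I_p, forall i, i <= p ->
    (v < i) = (box_col la k < sh i (box_row la k)).
  pose P i := box_col la k < sh i (box_row la k).
  have Pp : P p by rewrite /P shp box_col_lt.
  have [[|v] Pv v_min] := ex_minnP (ex_intro P p Pp); first by rewrite /P sh0 in Pv.
  exists (Ordinal (v_min _ Pp)) => i _ /=; apply/idP/idP => [lt_vi|Pi].
    exact: leq_trans Pv (chain_mono _ lace lt_vi).
  exact: v_min.
have [t t_entry] := fin_all_exists entry.
exists [ffun k => t k] => [|i k le_ip]; last by rewrite ffunE t_entry.
rewrite inE; apply/forallP => k; apply/forallP => l; rewrite !ffunE.
apply/andP; split; apply/implyP => /andP[/eqP eq_b lt_b].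
  rewrite t_entry ?(ltnW (ltn_ord _)) // eq_b.
  have : t l < (t l).+1 by [].
  rewrite t_entry // => /leq_trans; apply.
  (* by interlacing, the box above one that appears at a step is there before *)
  have [_ le1] := lace (t l) (box_row la l).-1.
  rewrite prednK ?(leq_ltn_trans _ lt_b) // in le1.
  apply: leq_trans le1 (interlace_noninc (lace _) _).
  by rewrite -ltnS prednK ?(leq_ltn_trans _ lt_b).
rewrite -ltnS t_entry // eq_b; apply: ltn_trans lt_b _.
by rewrite -t_entry.
Qed.

Lemma chain_of_tableau la t (sh sh' : nat -> nat -> nat) i :
  (forall i, interlace (sh i) (sh i.+1)) -> (forall i, interlace (sh' i) (sh' i.+1)) ->
  (forall r, nth 0 (parts la) r = sh p r) -> (forall r, nth 0 (parts la) r = sh' p r) ->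
  records la t sh -> records la t sh' -> i <= p -> sh i =1 sh' i.
Proof.
have half S S' r : (forall i, interlace (S' i) (S' i.+1)) ->
    (forall r, nth 0 (parts la) r = S' p r) -> records la t S -> records la t S' ->
    i <= p -> S' i r <= S i r.
  move=> lace def_la t_S t_S' le_ip; rewrite leqNgt; apply/negP => lt_r.
  (* the first box of row r by which S' exceeds S *)
  have /box_ex[k row_k col_k] : S i r < nth 0 (parts la) r.
    by rewrite def_la; apply: leq_trans lt_r (chain_mono _ lace le_ip).
  by have := t_S i k le_ip; rewrite t_S' // row_k col_k ltnn lt_r.
move=> lace lace' def_la def_la' t_sh t_sh' le_ip r.
by apply/eqP; rewrite eqn_leq (half sh' sh) ?(half sh sh').
Qed.

Definition letter_count a b (i j : nat) : nat :=
  #|[pred k | (val (a k) == i) && (val (b k) == j)]|.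

Lemma sum_letter_count a b :
  \sum_(i < p) \sum_(j < p) letter_count a b i j = n.
Proof.
rewrite pair_big /= -[RHS]card_ord -sum1_card.
rewrite (partition_big (fun k => (a k, b k)) predT) //=.
apply: eq_bigr => -[i j] _; rewrite sum1dep_card -sum1_card -[LHS]sum1_card.
by apply: eq_bigl => k; rewrite !inE.
Qed.

(** The letter counts are the multiplicities of the sequence of pairs of letters,
    and sequences with equal multiplicities are permutations of each other. *)
Lemma eq_letter_count a b a' b' :
  (forall i j : 'I_p, letter_count a b i j = letter_count a' b' i j) ->
  exists s : 'S_n, a' = word_act s a /\ b' = word_act s b.
Proof.
move=> eq_count; pose w (x y : word n p) := [tuple (x k, y k) | k < n].
have /tuple_permP[s def_s] : perm_eq (w a' b') (w a b).
  have count_w x y ij : count_mem ij (w x y) = letter_count x y ij.1 ij.2.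
    rewrite /w /= count_map /letter_count -size_filter cardE /enum_mem.
    rewrite -filter_predI; congr size; apply: eq_filter => k; rewrite /= !inE andbT.
    by case: ij.
  by apply/allP => ij _; rewrite /= !count_w eq_count.
exists (s^-1)%g.
have {}def_s k : (a' k, b' k) = (a (s k), b (s k)).
  have := congr1 (fun u => nth (a' k, b' k) u k) def_s.
  by rewrite !nth_mktuple tnth_mktuple.
by split; apply/ffunP => k; rewrite ffunE invgK; case: (def_s k).
Qed.

(** The two tableaux of a pair of words record how the diagram of the matrix of
    letter counts grows along its two outer borders. *)
Definition rsk_related a b la t s :=
  let G := growth (letter_count a b) in
  [/\ forall r, nth 0 (parts la) r = G p p r,
      records la t (fun i => G i p) & records la s (G p)].

Lemma rsk_ex a b :
  exists la, exists2 t, t \in ssyt la & exists2 s, s \in ssyt la & rsk_related a b la t s.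
Proof.
pose G := growth (letter_count a b).
have [la def_la] : exists la, forall r, nth 0 (parts la) r = G p p r.
  apply: (@partition_of_fun _ (n + p)); rewrite ?leq_addr //.
  - by move=> r s; apply: interlace_noninc (growth_chainr _ p p).
  - exact: growth_eq0.
  - by rewrite sum_growth ?leq_addl // sum_letter_count.
have [||r|t t_ssyt t_rec] := @tableau_of_chain la (fun i => G i p).
- exact: growth_chainl.
- by [].
- by rewrite def_la.
have [|r|r|s s_ssyt s_rec] := @tableau_of_chain la (G p).
- exact: growth_chainr.
- by rewrite /G growth0r.
- by rewrite def_la.
by exists la, t => //; exists s.
Qed.

Lemma rsk_inj a b a' b' la t s :
  rsk_related a b la t s -> rsk_related a' b' la t s ->
  exists g : 'S_n, a' = word_act g a /\ b' = word_act g b.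
Proof.
move=> [def_la t_rec s_rec] [def_la' t_rec' s_rec'].
apply: eq_letter_count => i j; apply: (@growth_inj _ _ p) => // {j}i.
  apply: (chain_of_tableau (sh := fun i => growth _ i p) (sh' := fun i => growth _ i p)
            _ _ def_la def_la' t_rec t_rec') => j; exact: growth_chainl.
apply: (chain_of_tableau (sh := growth _ p) (sh' := growth _ p)
          _ _ def_la def_la' s_rec s_rec') => j; exact: growth_chainr.
Qed.

End WordPairs.

Local Open Scope ring_scope.

(** * Young symmetrizers acting on words *)

Section RowAndColumnGroups.

Variables n p : nat.
Implicit Types (s : 'S_n) (la : partition_of n p).

Lemma col_groupP la s :
  reflect (forall k, box_col la (s k) = box_col la k) (s \in col_group la).
Proof. by rewrite inE; apply: (iffP forallP) => col_s k; apply/eqP. Qed.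

Lemma row_groupP la s :
  reflect (forall k, box_row la (s k) = box_row la k) (s \in row_group la).
Proof. by rewrite inE; apply: (iffP forallP) => row_s k; apply/eqP. Qed.

Lemma col_group_set la : group_set (col_group la).
Proof.
apply/group_setP; split; first by apply/col_groupP => k; rewrite perm1.
move=> s t /col_groupP col_s /col_groupP col_t; apply/col_groupP => k.
by rewrite permM col_t col_s.
Qed.

Lemma row_group_set la : group_set (row_group la).
Proof.
apply/group_setP; split; first by apply/row_groupP => k; rewrite perm1.
move=> s t /row_groupP row_s /row_groupP row_t; apply/row_groupP => k.
by rewrite permM row_t row_s.
Qed.

Canonical col_group_group la := Group (col_group_set la).
Canonical row_group_group la := Group (row_group_set la).

Lemma tperm_col la k l : box_col la k = box_col la l -> tperm k l \in col_group la.
Proof. by move=> eq_kl; apply/col_groupP => i; case: tpermP => [->|->|]. Qed.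

Lemma tperm_row la k l : box_row la k = box_row la l -> tperm k l \in row_group la.
Proof. by move=> eq_kl; apply/row_groupP => i; case: tpermP => [->|->|]. Qed.

End RowAndColumnGroups.

Section WordAction.

Variables (C : numClosedFieldType) (n p : nat).
Local Notation N := #|word n p|.
Implicit Types (h s t : 'S_n) (a : word n p) (la mu : partition_of n p).

Lemma word_act1 a : word_act 1%g a = a.
Proof. by apply/ffunP => i; rewrite ffunE invg1 perm1. Qed.

Lemma word_actM s t a : word_act s (word_act t a) = word_act (t * s)%g a.
Proof. by apply/ffunP => i; rewrite !ffunE invMg permM. Qed.

Lemma word_actK s : cancel (@word_act n p s) (word_act s^-1%g).
Proof. by move=> a; rewrite word_actM mulgV word_act1. Qed.

Lemma word_actKV s : cancel (word_act s^-1%g) (@word_act n p s).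
Proof. by move=> a; rewrite word_actM mulVg word_act1. Qed.

Definition act_mx s : 'M[C]_N :=
  \matrix_(i, j) (enum_val i == word_act s (enum_val j))%:R.

Lemma act_mx_mulE s m (M : 'M_(N, m)) i j :
  (act_mx s *m M) i j = M (enum_rank (word_act s^-1%g (enum_val i))) j.
Proof.
rewrite mxE (bigD1 (enum_rank (word_act s^-1%g (enum_val i)))) //= big1 ?addr0.
  by rewrite mxE enum_rankK word_actKV eqxx mul1r.
move=> k neq_k; rewrite mxE; case: eqP => [def_i|]; last by rewrite mul0r.
by case/eqP: neq_k; rewrite def_i word_actK enum_valK.
Qed.

Lemma act_mxM s t : act_mx s *m act_mx t = act_mx (t * s)%g.
Proof.
apply/matrixP => i j; rewrite act_mx_mulE !mxE enum_rankK -word_actM.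
congr (nat_of_bool _)%:R.
by rewrite -[LHS](inj_eq (@word_act_inj _ _ s)) word_actKV.
Qed.

Lemma act_mx1 : act_mx 1%g = 1%:M.
Proof.
by apply/matrixP => i j; rewrite !mxE word_act1 (inj_eq enum_val_inj).
Qed.

Lemma trmx_act s : (act_mx s)^T = act_mx s^-1%g.
Proof.
apply/matrixP => i j; rewrite !mxE; congr (nat_of_bool _)%:R.
by rewrite -[RHS](inj_eq (@word_act_inj _ _ s)) word_actKV eq_sym.
Qed.

Lemma mx_actE s (M : 'M[C]_N) : mx_act s M = act_mx s *m M *m (act_mx s)^T.
Proof.
apply/matrixP => i j; rewrite -[act_mx s *m M]trmxK -trmx_mul mxE.
by rewrite [RHS]mxE act_mx_mulE mxE act_mx_mulE.
Qed.

Lemma act_mx_chi s a : act_mx s *m chi C a = chi C (word_act s a).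
Proof.
apply/matrixP => i j; rewrite act_mx_mulE !mxE (inj_eq enum_rank_inj).
congr (nat_of_bool (_ && _))%:R; rewrite -(inj_eq enum_val_inj) enum_rankK.
by rewrite -[LHS](inj_eq (@word_act_inj _ _ s)) word_actKV.
Qed.

Definition col_antisym la : 'M[C]_N := \sum_(s in col_group la) (-1) ^+ s *: act_mx s.
Definition row_sym la : 'M[C]_N := \sum_(s in row_group la) act_mx s.
Definition young_sym la : 'M[C]_N := col_antisym la *m row_sym la.

Lemma row_symM la m (M : 'M[C]_(N, m)) :
  (forall t, t \in row_group la -> act_mx t *m M = M) ->
  row_sym la *m M = #|row_group la|%:R *: M.
Proof.
move=> invM; rewrite mulmx_suml (eq_bigr (fun _ => M)) // sumr_const.
by rewrite scaler_nat.
Qed.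

Lemma col_antisymM la s : s \in col_group la ->
  col_antisym la *m act_mx s = (-1) ^+ s *: col_antisym la.
Proof.
move=> col_s; rewrite mulmx_suml scaler_sumr (reindex_inj (mulgI s^-1%g)) /=.
apply: eq_big => [t|t _].
  by rewrite groupMl ?groupV.
by rewrite -scalemxAl act_mxM mulKVg scalerA odd_permM odd_permV signr_addb.
Qed.

Lemma act_row_sym la s : s \in row_group la -> act_mx s *m row_sym la = row_sym la.
Proof.
move=> row_s; rewrite mulmx_sumr [RHS](reindex_inj (mulIg s)) /=.
apply: eq_big => [t|t _]; last by rewrite act_mxM.
by rewrite groupMr.
Qed.

Lemma trmx_col_antisym la : (col_antisym la)^T = col_antisym la.
Proof.
rewrite /col_antisym raddf_sum [LHS](reindex_inj invg_inj) /=.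
apply: eq_big => [t|t _].
  by rewrite groupV.
by rewrite linearZ /= trmx_act invgK odd_permV.
Qed.

Lemma trmx_row_sym la : (row_sym la)^T = row_sym la.
Proof.
rewrite /row_sym raddf_sum [LHS](reindex_inj invg_inj) /=.
apply: eq_big => [t|t _]; last by rewrite trmx_act invgK.
by rewrite groupV.
Qed.

(** A transposition of two boxes in a row of [la] is absorbed by the row
    symmetrizer; carried across [h] it becomes a transposition within a column
    of [mu], which the column antisymmetrizer turns into a sign. *)
Lemma antisym_act_sym_eq0 la mu h k l : k != l ->
  box_row la k = box_row la l -> box_col mu (h k) = box_col mu (h l) ->
  col_antisym mu *m act_mx h *m row_sym la = 0.
Proof.
move=> neq_kl eq_row eq_col; set X := _ *m row_sym la.
suff: X = - X.
  by move/eqP; rewrite -addr_eq0 -mulr2n -scaler_nat scaler_eq0 pnatr_eq0 => /eqP.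
rewrite {1}/X -(act_row_sym (tperm_row eq_row)) !mulmxA -(mulmxA (col_antisym mu)).
rewrite act_mxM conjgC tpermJ -act_mxM mulmxA (col_antisymM (tperm_col eq_col)).
by rewrite odd_tperm (inj_eq perm_inj) neq_kl expr1 scaleN1r !mulNmx.
Qed.

(** Von Neumann's lemma.  If no pair of boxes makes the product vanish, then [h]
    spreads the rows of [la] over distinct columns of [mu], which under the
    hypothesis on [leg_sum] forces [la = mu] and makes [h] a product of a row and
    a column permutation. *)
Lemma antisym_act_sym la mu h :
  (leg_sum la <= leg_sum mu)%N ->
  exists c, col_antisym mu *m act_mx h *m row_sym la =
            (if la == mu then c else 0) *: young_sym la.
Proof.
move=> le_leg.
have [/existsP[k /existsP[l /and3P[neq_kl /eqP eq_row /eqP eq_col]]]|no_pair] :=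
  boolP [exists k, exists l, [&& k != l, box_row la k == box_row la l
                                & box_col mu (h k) == box_col mu (h l)]].
  by exists 0; rewrite (antisym_act_sym_eq0 neq_kl eq_row eq_col) if_same scale0r.
have [|le_leg' eq_leg] := @rows_to_distinct_columns n p la mu h.
  move=> k l eq_row eq_col; apply: contraNeq no_pair => neq_kl.
  by apply/existsP; exists k; apply/existsP; exists l; rewrite neq_kl eq_row eq_col !eqxx.
have [|<- [rho row_rho col_rho]] := eq_leg; first by apply/eqP; rewrite eqn_leq le_leg'.
exists ((-1) ^+ (rho^-1 * h)%g); rewrite eqxx /young_sym.
rewrite -{1}[h](mulKVg rho) -act_mxM mulmxA col_antisymM // -!mulmxA act_row_sym //.
by rewrite scalemxAl.
Qed.

Lemma sym_act_antisym la mu h :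
  row_sym mu *m act_mx h *m col_antisym la =
  \sum_(s in row_group mu) \sum_(t in col_group la)
     (-1) ^+ t *: act_mx (t * h * s)%g.
Proof.
rewrite !mulmx_suml; apply: eq_bigr => s _; rewrite mulmx_sumr; apply: eq_bigr => t _.
by rewrite -scalemxAr !act_mxM mulgA.
Qed.

(** The inner factors [row_sym mu *m act_mx h *m col_antisym la] are a combination
    of permutations, and each of them is absorbed by the outer factors. *)
Lemma young_sandwich la mu h : (leg_sum la <= leg_sum mu)%N ->
  exists c, young_sym mu *m act_mx h *m young_sym la =
            (if la == mu then c else 0) *: young_sym la.
Proof.
move=> le_leg.
have [c cP] := fin_all_exists (fun s => @antisym_act_sym la mu s le_leg).
exists (\sum_(s in row_group mu) \sum_(t in col_group la) (-1) ^+ t * c (t * h * s)%g).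
have -> : young_sym mu *m act_mx h *m young_sym la =
  col_antisym mu *m (row_sym mu *m act_mx h *m col_antisym la) *m row_sym la.
  by rewrite /young_sym !mulmxA.
rewrite sym_act_antisym; move: cP.
move: (col_antisym mu) (row_sym la) => A S cP; rewrite mulmx_sumr mulmx_suml.
transitivity (\sum_(s in row_group mu) \sum_(t in col_group la)
   ((-1) ^+ t * (if la == mu then c (t * h * s)%g else 0)) *: young_sym la).
  apply: eq_bigr => s _; rewrite mulmx_sumr mulmx_suml; apply: eq_bigr => t _.
  by rewrite -scalemxAr -scalemxAl cP scalerA.
case: ifP => _.
  by rewrite [RHS]scaler_suml; apply: eq_bigr => s _; rewrite [RHS]scaler_suml.
by rewrite scale0r big1 // => s _; rewrite big1 // => t _; rewrite mulr0 scale0r.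
Qed.

Lemma young_sym_quasi_idem la h :
  exists c, young_sym la *m act_mx h *m young_sym la = c *: young_sym la.
Proof. by have := @young_sandwich la la h (leqnn _); rewrite eqxx. Qed.

(** Von Neumann's lemma applies to the outer factors if
    [leg_sum la <= leg_sum mu], and to the transpose of the inner ones otherwise. *)
Lemma young_sym_orthogonal la mu h : la != mu ->
  young_sym mu *m act_mx h *m young_sym la = 0.
Proof.
move=> neq_la; have [le_leg|/ltnW le_leg] := leqP (leg_sum la) (leg_sum mu).
  by have [c ->] := young_sandwich h le_leg; rewrite (negbTE neq_la) scale0r.
rewrite /young_sym -!mulmxA [row_sym mu *m _]mulmxA [X in _ *m X]mulmxA.
have [c] := antisym_act_sym h^-1%g le_leg.
rewrite eq_sym (negbTE neq_la) scale0r => /(congr1 trmx).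
rewrite !trmx_mul trmx_row_sym trmx_act invgK trmx_col_antisym trmx0 mulmxA => ->.
by rewrite mul0mx mulmx0.
Qed.

End WordAction.

(** * Linear independence of the vectors of semistandard tableaux *)

Section SemistandardVectors.

Variables (C : numClosedFieldType) (n p : nat) (la : partition_of n p).
Local Notation N := #|word n p|.
Implicit Types (s : 'S_n) (t u : word n p) (k l : 'I_n).

Lemma ssyt_col_lt u k l : u \in ssyt la -> box_col la k = box_col la l ->
  (box_row la k < box_row la l)%N -> (u k < u l)%N.
Proof.
rewrite inE => /forallP/(_ k)/forallP/(_ l)/andP[/implyP u_col _] eq_c lt_r.
by apply: u_col; rewrite eq_c eqxx.
Qed.

Lemma ssyt_row_le u k l : u \in ssyt la -> box_row la k = box_row la l ->
  (box_col la k <= box_col la l)%N -> (u k <= u l)%N.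
Proof.
rewrite inE => /forallP/(_ k)/forallP/(_ l)/andP[_ /implyP u_row] eq_r.
rewrite leq_eqVlt => /predU1P[eq_c|lt_c]; first by rewrite (box_inj eq_r eq_c).
by apply: u_row; rewrite eq_r eqxx.
Qed.

Lemma row_equiv_act s t u : s \in row_group la ->
  row_equiv la t (word_act s u) = row_equiv la t u.
Proof.
move=> row_s; apply/exists_inP/exists_inP => -[r row_r /eqP def_u].
  exists (r * s^-1)%g; last by rewrite -word_actM -def_u word_actK.
  by rewrite groupM ?groupV.
exists (r * s)%g; last by rewrite -word_actM -def_u.
exact: groupM.
Qed.

Definition tabloid_vec t : 'cV[C]_N := \sum_(t' | row_equiv la t t') chi C t'.

Lemma act_tabloid_vec s t : s \in row_group la ->
  act_mx C p s *m tabloid_vec t = tabloid_vec t.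
Proof.
move=> row_s; rewrite mulmx_sumr [RHS](reindex_inj (@word_act_inj _ _ s)) /=.
by apply: eq_big => [u|u _]; rewrite ?row_equiv_act // act_mx_chi.
Qed.

Lemma tab_vecE t : tab_vec la C t = col_antisym C la *m tabloid_vec t.
Proof.
rewrite [RHS]mulmx_suml; apply: eq_bigr => s _; rewrite -scalemxAl mulmx_sumr.
by congr (_ *: _); apply: eq_bigr => u _; rewrite act_mx_chi.
Qed.

(** Row permutations fix the sum over a row class, so symmetrizing it only
    multiplies it by the order of the row group. *)
Lemma tab_basis_young : exists X, tab_basis la C = young_sym C la *m X.
Proof.
pose c : C := #|row_group la|%:R.
have c_neq0 : c != 0.
  by rewrite pnatr_eq0 -lt0n cardG_gt0.
exists (\matrix_(k, j) (c^-1 *: tabloid_vec (enum_val j)) k 0).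
apply/matrixP => k j; rewrite mxE tab_vecE.
have -> : tabloid_vec (enum_val j) =
    row_sym C la *m (c^-1 *: tabloid_vec (enum_val j)).
  rewrite -scalemxAr row_symM => [|s]; last exact: act_tabloid_vec.
  by rewrite scalerA mulVf // scale1r.
by rewrite mulmxA mxE [RHS]mxE; apply: eq_bigr => i _; rewrite [X in _ = _ * X]mxE.
Qed.

Lemma tab_vec_coef t u :
  tab_vec la C t (enum_rank u) 0 =
  \sum_(s in col_group la) (-1) ^+ s * (row_equiv la t (word_act s^-1%g u))%:R.
Proof.
rewrite summxE; apply: eq_bigr => s _; rewrite !mxE; congr (_ * _).
rewrite summxE big_mkcond (bigD1 (word_act s^-1%g u)) //= big1 ?addr0.
  by rewrite word_actKV mxE !eqxx; case: ifP.
move=> v neq_v; case: ifP => // _; rewrite mxE andbT (inj_eq enum_rank_inj).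
by case: eqP => // def_u; case/eqP: neq_v; rewrite def_u word_actK.
Qed.

Lemma tab_basis_conj : map_mx Num.conj (tab_basis la C) = tab_basis la C.
Proof.
apply/matrixP => k j; rewrite !mxE -(enum_valK k) tab_vec_coef rmorph_sum.
by apply: eq_bigr => s _; rewrite rmorphM /= rmorph_sign rmorph_nat.
Qed.

(** Row permutations preserve this weight, and among the rearrangements of a
    column it is largest when the entries increase downwards. *)
Definition row_weight u : nat := \sum_k box_row la k * u k.

Lemma row_weight_equiv t u : row_equiv la t u -> row_weight u = row_weight t.
Proof.
case/exists_inP=> s /row_groupP row_s /eqP ->.
rewrite /row_weight (reindex_inj (@perm_inj _ s)); apply: eq_bigr => k _.
by rewrite row_s ffunE permK.
Qed.

(** A rearrangement of columns that moves some box does not have maximal weight: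
    exchanging the entry that arrives in the lowest moved box with the one that
    belongs there increases the weight, as columns increase.  So the identity is
    the only maximum. *)
Lemma row_weight_col s u : u \in ssyt la -> s \in col_group la -> s != 1%g ->
  (row_weight (word_act s u) < row_weight u)%N.
Proof.
move=> u_ss; pose w (r : 'S_n) := (\sum_k box_row la k * u (r k))%N.
have improve (r : 'S_n) : r \in col_group la -> r != 1%g ->
    exists2 r', r' \in col_group la & (w r < w r')%N.
  move=> /col_groupP col_r r_neq1.
  have [x0 r_x0] : exists x, r x != x.
    apply/existsP; apply: contraNT r_neq1 => /existsPn r1.
    by apply/eqP/permP => x; rewrite perm1; apply/eqP/negbNE/r1.
  case: (@arg_maxnP _ x0 (fun x => r x != x) (box_row la) r_x0) => x r_x x_max.
  have below y : r y != y -> box_col la y = box_col la x -> y != x ->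
      (box_row la y < box_row la x)%N.
    move=> r_y eq_c; rewrite ltn_neqAle (x_max y r_y : (_ <= _)%N) andbT.
    apply: contraNneq => eq_r.
    by rewrite (box_inj eq_r eq_c).
  pose z := (r^-1)%g x; have r_z : r z = x by rewrite permKV.
  have neq_zx : z != x by apply: contraNneq r_x => eq_z; rewrite -{1}eq_z r_z.
  have col_z : box_col la z = box_col la x by rewrite -(col_r z) r_z.
  have lt_z : (box_row la z < box_row la x)%N by rewrite below // r_z eq_sym.
  have lt_u : (u (r x) < u x)%N.
    by apply: ssyt_col_lt => //; apply: below; rewrite ?(inj_eq perm_inj) ?col_r.
  exists (tperm x z * r)%g.
    by rewrite groupM ?tperm_col //; apply/col_groupP.
  rewrite /w (bigD1 x) // (bigD1 z) //= [ltnRHS](bigD1 x) // [in ltnRHS](bigD1 z) //=.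
  rewrite !permM tpermL tpermR r_z !addnA.
  rewrite [X in (_ < _ + X)%N](eq_bigr (fun k => box_row la k * u (r k))%N).
    rewrite ltn_add2r; nia.
  by move=> k /andP[neq_x neq_z]; rewrite permM tpermD // eq_sym.
have w_max (r : 'S_n) : r \in col_group la -> (w r <= w 1%g)%N.
  move=> col_r.
  case: (@arg_maxnP _ 1%g (mem (col_group la)) w (group1 _)) => r0 col_r0 r0_max.
  have [<-|neq1] := eqVneq r0 1%g; first exact: r0_max.
  have [r' col_r'] := improve _ col_r0 neq1.
  by rewrite ltnNge => /negP[]; apply: r0_max.
move=> col_s s_neq1; have -> : row_weight u = w 1%g.
  by apply: eq_bigr => k _; rewrite perm1.
have -> : row_weight (word_act s u) = w s^-1%g.
  by apply: eq_bigr => k _; rewrite ffunE.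
have col_sV : s^-1%g \in col_group la.
  by rewrite groupV.
have [|r' col_r' lt_w] := improve _ col_sV; first by rewrite invg_eq1.
exact: leq_trans lt_w (w_max _ col_r').
Qed.

(** Rows are sorted, so the entries below [v] fill an initial segment of a row. *)
Lemma ssyt_entry_lt u k v : u \in ssyt la ->
  (u k < v)%N =
  (box_col la k < #|[pred l | (box_row la l == box_row la k) && (u l < v)]|)%N.
Proof.
move=> u_ss; set A := [pred l | _].
have col_inj : {in A &, injective (box_col la)}.
  move=> l m /andP[/eqP row_l _] /andP[/eqP row_m _]; apply: box_inj.
  by rewrite row_l.
apply/idP/idP => [lt_v|]; last first.
  apply: contraTT; rewrite -!leqNgt => le_v.
  apply: (card_inj_lt col_inj) => l /andP[/eqP row_l lt_l].
  rewrite ltnNge; apply: contraTN lt_l => le_c; rewrite -leqNgt.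
  exact: leq_trans le_v (ssyt_row_le u_ss _ le_c).
have [f fr fc] := fin_all_exists2 (fun c : 'I_(box_col la k).+1 =>
  box_ex (leq_trans (ltn_ord c) (box_col_lt la k))).
have f_inj : injective f by move=> c d /(congr1 (box_col la)); rewrite !fc => /val_inj.
rewrite -[(box_col la k).+1]card_ord -(card_imset _ f_inj).
apply/subset_leq_card/subsetP => _ /imsetP[c _ ->]; rewrite inE fr eqxx /=.
by apply: leq_ltn_trans lt_v; apply: ssyt_row_le; rewrite ?fr ?fc // -ltnS.
Qed.

Lemma ssyt_row_equiv t u :
  t \in ssyt la -> u \in ssyt la -> row_equiv la t u -> u = t.
Proof.
move=> t_ss u_ss /exists_inP[s /row_groupP row_s /eqP def_u].
have eq_lt v k : (u k < v)%N = (t k < v)%N.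
  rewrite (ssyt_entry_lt _ _ u_ss) (ssyt_entry_lt _ _ t_ss) -!sum1_card.
  congr (_ < _)%N; rewrite [LHS](reindex_inj (@perm_inj _ s)) /=.
  by apply: eq_bigl => l; rewrite !inE row_s def_u ffunE permK.
apply/ffunP => k; apply: val_inj; apply/eqP; rewrite eqn_leq /=.
by rewrite -ltnS eq_lt ltnSn -ltnS -eq_lt ltnSn.
Qed.

(** A word with a nonzero coefficient in the vector of [t] is a column
    rearrangement of a row rearrangement of [t].  The latter has the weight of
    [t], and a semistandard word is heavier than its other column rearrangements. *)
Lemma tab_vec_triangular t u : t \in ssyt la -> u \in ssyt la ->
  (row_weight u <= row_weight t)%N ->
  tab_vec la C t (enum_rank u) 0 = (u == t)%:R.
Proof.
move=> t_ss u_ss le_w; rewrite tab_vec_coef (bigD1 1%g) ?group1 //=.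
rewrite odd_perm1 expr0 mul1r invg1 word_act1.
rewrite big1 ?addr0 => [|s /andP[col_s s_neq1]].
  congr (nat_of_bool _)%:R; apply/idP/eqP => [/ssyt_row_equiv->//|->].
  by apply/exists_inP; exists 1%g; rewrite ?group1 // word_act1.
case: (boolP (row_equiv _ _ _)) => [/row_weight_equiv eq_w|_]; last by rewrite mulr0.
have := @row_weight_col s^-1%g u u_ss; rewrite eq_w ltnNge le_w.
rewrite groupV invg_eq1.
by move=> /(_ col_s s_neq1).
Qed.

Lemma tab_basis_inj (y : 'cV[C]_#|ssyt la|) : tab_basis la C *m y = 0 -> y = 0.
Proof.
move=> By0; apply/eqP; apply: contraT => /cV0Pn[i0 y_i0].
pose weight (i : 'I_#|ssyt la|) := row_weight (enum_val i).
case: (@arg_minnP _ i0 (fun i => y i 0 != 0) weight y_i0) => i y_i i_min.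
have /matrixP/(_ (enum_rank (enum_val i)) 0) := By0; rewrite mxE [RHS]mxE (bigD1 i) //=.
rewrite big1 ?addr0 => [|j neq_ji].
  by rewrite mxE tab_vec_triangular ?enum_valP // eqxx mul1r => /eqP; rewrite (negbTE y_i).
have [->|y_j] := eqVneq (y j 0) 0; first by rewrite mulr0.
rewrite mxE tab_vec_triangular ?enum_valP //; last exact: i_min.
by rewrite (inj_eq enum_val_inj) eq_sym (negbTE neq_ji) mul0r.
Qed.

End SemistandardVectors.

Local Open Scope sesquilinear_scope.

(** * Invariant matrices from semistandard tableaux *)

Section MatrixFacts.

Variable C : numClosedFieldType.

Lemma adj_mulmx m q r (A : 'M[C]_(m, q)) (B : 'M[C]_(q, r)) :
  (A *m B) ^t* = B ^t* *m A ^t*.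
Proof. by rewrite trmx_mul map_mxM. Qed.

Lemma real_adjmx m q (A : 'M[C]_(m, q)) : map_mx Num.conj A = A -> A ^t* = A^T.
Proof. by rewrite -map_trmx => ->. Qed.

Lemma dot_ge0 m (x : 'cV[C]_m) : 0 <= (x ^t* *m x) 0 0.
Proof. by rewrite mxE sumr_ge0 // => i _; rewrite !mxE mulrC mul_conjC_ge0. Qed.

Lemma dot_eq0 m (x : 'cV[C]_m) : (x ^t* *m x) 0 0 = 0 -> x = 0.
Proof.
rewrite mxE => /eqP; rewrite psumr_eq0 => [/allP x0|i _]; last first.
  by rewrite !mxE mulrC mul_conjC_ge0.
apply/colP => i; have /(_ i) := x0; rewrite mem_index_enum !mxE mulrC mul_conjC_eq0.
by move=> /(_ isT)/eqP.
Qed.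

Lemma unitmx_inj m (A : 'M[C]_m) : (forall x : 'cV_m, A *m x = 0 -> x = 0) -> A \in unitmx.
Proof.
move=> injA; rewrite -unitmx_tr -row_free_unit; apply: inj_row_free => v vA0.
by rewrite -[v]trmxK [v^T]injA ?trmx0 // -[A]trmxK -trmx_mul vA0 trmx0.
Qed.

End MatrixFacts.

Section InvariantMatrices.

Variables (C : numClosedFieldType) (n p : nat).
Local Notation N := #|word n p|.
Implicit Types (g : 'S_n) (la mu : partition_of n p).
Local Notation W := (act_mx C p).
Local Notation B la := (tab_basis la C).

Lemma tab_basis_adj la : (B la) ^t* = (B la)^T.
Proof. exact/real_adjmx/tab_basis_conj. Qed.

Lemma tab_gram_unit la : tab_gram la C \in unitmx.
Proof.
apply: unitmx_inj => x Gx0; apply: (@tab_basis_inj C n p la); apply: dot_eq0.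
rewrite adj_mulmx tab_basis_adj -mulmxA (mulmxA (B la)^T) -/(tab_gram la C).
by rewrite Gx0 mulmx0 mxE.
Qed.

Definition conj_sum (X : 'M[C]_N) : 'M[C]_N := \sum_g W g *m X *m (W g)^T.

Lemma act_mx_trK g : W g *m (W g)^T = 1%:M.
Proof. by rewrite trmx_act act_mxM mulVg act_mx1. Qed.

Lemma act_conj_sum X h : W h *m conj_sum X = conj_sum X *m W h.
Proof.
rewrite /conj_sum mulmx_sumr mulmx_suml (reindex_inj (mulIg h^-1%g)) /=.
apply: eq_bigr => g _; rewrite !trmx_act !mulmxA act_mxM -[in RHS]mulmxA.
by rewrite act_mxM mulgKV invMg invgK.
Qed.

Lemma conj_sum_invariant X : conj_sum X \in @Sn_invariant C n p.
Proof.
apply/Sn_invariantP => s.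
by rewrite mx_actE act_conj_sum -mulmxA act_mx_trK mulmx1.
Qed.

Lemma young_conj_sum la X : young_sym C la *m conj_sum X = conj_sum X *m young_sym C la.
Proof.
have comm_sum (T : finType) (P : pred T) (c : T -> C) (f : T -> 'S_n) :
    (\sum_(s | P s) c s *: W (f s)) *m conj_sum X =
    conj_sum X *m \sum_(s | P s) c s *: W (f s).
  rewrite mulmx_suml mulmx_sumr; apply: eq_bigr => s _.
  by rewrite -scalemxAl act_conj_sum scalemxAr.
have row_comm : row_sym C la *m conj_sum X = conj_sum X *m row_sym C la.
  rewrite (_ : row_sym C la = \sum_(s in row_group la) 1 *: W s) ?comm_sum //.
  by apply: eq_bigr => s _; rewrite scale1r.
by rewrite /young_sym -mulmxA row_comm !mulmxA comm_sum.
Qed.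

(** Summing the conjugates makes [B la *m Y *m (B la)^T] invariant, and the
    matrices [Y] for the different shapes are coordinates of the invariant algebra
    that fit the tableau vectors. *)
Definition tab_inv la (Y : 'M[C]_#|ssyt la|) : 'M[C]_N :=
  conj_sum (B la *m Y *m (B la)^T).

Fact tab_inv_linear la : linear (@tab_inv la).
Proof.
move=> c X Y; rewrite /tab_inv /conj_sum scaler_sumr -big_split /=.
apply: eq_bigr => g _.
by rewrite mulmxDr !mulmxDl mulmxDr mulmxDl -!scalemxAr -!scalemxAl -scalemxAr -scalemxAl.
Qed.

HB.instance Definition _ la :=
  GRing.isLinear.Build C _ _ _ (@tab_inv la) (@tab_inv_linear la).

Lemma conj_sum_basis la mu Y X : B mu = young_sym C mu *m X ->
  tab_inv (la := la) Y *m B mu =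
  \sum_g young_sym C mu *m W g *m B la *m (Y *m (B la)^T *m (W g)^T *m X).
Proof.
move=> def_B; rewrite {1}def_B mulmxA -young_conj_sum mulmx_sumr mulmx_suml.
by apply: eq_bigr => g _; rewrite !mulmxA.
Qed.

Lemma tab_inv_off_diag la mu (Y : 'M_#|ssyt la|) :
  la != mu -> tab_inv Y *m B mu = 0.
Proof.
move=> neq_la; have [X def_B] := tab_basis_young C mu.
have [Xla def_Bla] := tab_basis_young C la.
rewrite (conj_sum_basis _ def_B) big1 // => g _.
by rewrite {1}def_Bla (mulmxA _ (young_sym C la)) young_sym_orthogonal // !mul0mx.
Qed.

(** Schur's lemma in coordinates.  A Young symmetrizer reproduces itself up to
    scalars, which gives [K].  For [Y = 1] the matrix [tab_gram la C *m K] is a sum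
    of matrices of the form [M *m M ^t*], one of them with [M = tab_gram la C]
    invertible, so that [K] is injective. *)
Lemma tab_inv_diag la : exists2 K, K \in unitmx &
  forall Y : 'M_#|ssyt la|, tab_inv Y *m B la = B la *m Y *m K.
Proof.
have [X def_B] := tab_basis_young C la.
have [c cP] := fin_all_exists (fun g => young_sym_quasi_idem C la g).
pose K := \sum_g c g *: ((B la)^T *m (W g)^T *m X).
have KP (Y : 'M_#|ssyt la|) : tab_inv Y *m B la = B la *m Y *m K.
  rewrite (conj_sum_basis _ def_B) mulmx_sumr; apply: eq_bigr => g _.
  have -> : young_sym C la *m W g *m B la = c g *: B la.
    by rewrite {1}def_B mulmxA cP -scalemxAl -def_B.
  by rewrite -scalemxAl -scalemxAr !mulmxA.
exists K => //; apply: unitmx_inj => x Kx0.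
pose z g := (B la)^T *m (W g)^T *m B la *m x.
have sum_z : \sum_g ((z g) ^t* *m z g) 0 0 = 0.
  have W_conj g : map_mx Num.conj (W g) = W g.
    by apply/matrixP => i j; rewrite !mxE rmorph_nat.
  have z_adj g : (z g) ^t* = x ^t* *m (B la)^T *m W g *m B la.
    by rewrite !adj_mulmx tab_basis_adj !trmxK W_conj tab_basis_conj !mulmxA.
  transitivity ((x ^t* *m (B la)^T *m (tab_inv (1%:M : 'M_#|ssyt la|) *m B la *m x)) 0 0).
    rewrite /tab_inv mulmx1 !mulmx_suml mulmx_sumr summxE; apply: eq_bigr => g _.
    by rewrite z_adj /z !mulmxA.
  by rewrite KP -!mulmxA Kx0 !mulmx0 mxE.
have : z 1%g = 0.
  apply: dot_eq0; move/eqP: sum_z; rewrite psumr_eq0 => [/allP z0|g _]; last exact: dot_ge0.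
  by apply/eqP/z0; rewrite mem_index_enum.
rewrite /z act_mx1 trmx1 mulmx1 => /(congr1 (mulmx (invmx (tab_gram la C)))).
by rewrite mulmxA mulVmx ?tab_gram_unit // mul1mx mulmx0.
Qed.

Lemma sum_tab_inv_basis (Y : forall la, 'M[C]_#|ssyt la|) mu :
  (\sum_la tab_inv (Y la)) *m B mu = tab_inv (Y mu) *m B mu.
Proof.
rewrite mulmx_suml (bigD1 mu) //= big1 ?addr0 // => la neq_la.
exact: tab_inv_off_diag.
Qed.

Lemma sum_tab_inv_inj (Y : forall la, 'M[C]_#|ssyt la|) mu :
  \sum_la tab_inv (Y la) = 0 -> Y mu = 0.
Proof.
move=> sum0; have [K K_unit KP] := tab_inv_diag mu.
have := sum_tab_inv_basis Y mu; rewrite sum0 mul0mx KP.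
move=> /esym/(congr1 (fun M => invmx (tab_gram mu C) *m ((B mu)^T *m (M *m invmx K)))).
rewrite mulmxK // (mulmxA (B mu)^T) -/(tab_gram mu C) mulKmx ?tab_gram_unit // => ->.
by rewrite mul0mx !mulmx0.
Qed.

(** A dimension count.  Indexed by the pairs of semistandard tableaux of equal
    shape, the matrices [tab_inv (delta_mx s t)] are independent; and as invariant
    matrices are constant on pairs of words with the same pair of tableaux, they
    lie in a space spanned by equally many indicator matrices. *)
Lemma tab_inv_span (A : 'M[C]_N) : A \in @Sn_invariant C n p ->
  exists Y : forall la, 'M[C]_#|ssyt la|, A = \sum_la tab_inv (Y la).
Proof.
move=> invA.
pose J_ la := ('I_#|ssyt la| * 'I_#|ssyt la|)%type.
pose J := {la : partition_of n p & J_ la}.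
have rsk_ex_index (ab : word n p * word n p) : exists j : J,
    rsk_related ab.1 ab.2 (tag j) (enum_val (tagged j).1) (enum_val (tagged j).2).
  case: ab => a b /=; have [la [t t_ss [s s_ss related]]] := rsk_ex a b.
  by exists (Tagged J_ (enum_rank_in t_ss t, enum_rank_in s_ss s)); rewrite /= !enum_rankK_in.
have [phi phiP] := fin_all_exists rsk_ex_index.
(* The rows of D are the indicator matrices of the fibres of phi. *)
pose D : 'M[C]_(#|{: J}|, N * N) := \matrix_j
  mxvec (\matrix_(k, l) (phi (enum_val k, enum_val l) == enum_val j)%:R).
have inv_sub_D (M : 'M[C]_N) : M \in @Sn_invariant C n p -> (mxvec M <= D)%MS.
  move=> /Sn_invariantP invM.
  have M_phi ab ab' : phi ab = phi ab' ->
      M (enum_rank ab.1) (enum_rank ab.2) = M (enum_rank ab'.1) (enum_rank ab'.2).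
    move=> eq_phi; have := phiP ab; rewrite eq_phi => /rsk_inj/(_ (phiP ab'))[g [-> ->]].
    by rewrite -[in RHS](invM g) mxE !enum_rankK !word_actK.
  pose x : 'rV[C]_#|{: J}| := \row_j
    if [pick ab | phi ab == enum_val j] is Some ab
    then M (enum_rank ab.1) (enum_rank ab.2) else 0.
  suff -> : mxvec M = x *m D by apply: submxMl.
  rewrite mulmx_sum_row -[RHS]vec_mxK; congr mxvec; apply/matrixP => k l.
  rewrite linear_sum summxE /= (bigD1 (enum_rank (phi (enum_val k, enum_val l)))) //=.
  rewrite big1 ?addr0 => [|j neq_j].
    rewrite rowK linearZ /= mxvecK !mxE enum_rankK eqxx mulr1.
    case: pickP => [ab /eqP/M_phi-> /=|/(_ (enum_val k, enum_val l))]; last by rewrite eqxx.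
    by rewrite !enum_valK.
  rewrite rowK linearZ /= mxvecK !mxE; case: eqP => [def_j|_]; last by rewrite mulr0.
  by case/eqP: neq_j; rewrite def_j enum_valK.
pose E : 'M[C]_(#|{: J}|, N * N) := \matrix_j
  mxvec (tab_inv (delta_mx (tagged (enum_val j)).1 (tagged (enum_val j)).2)).
pose coord (y : 'rV[C]_#|{: J}|) la : 'M[C]_#|ssyt la| :=
  \matrix_(s, t) y 0 (enum_rank (Tagged J_ (s, t))).
have yE y : y *m E = mxvec (\sum_la tab_inv (coord y la)).
  pose F la (st : J_ la) :=
    y 0 (enum_rank (Tagged J_ st)) *: mxvec (tab_inv (delta_mx st.1 st.2)).
  transitivity (\sum_(j : J) F (tag j) (tagged j)).
    rewrite mulmx_sum_row (reindex (@enum_rank {: J})) /=; last exact/onW_bij/enum_rank_bij.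
    by apply: eq_bigr => -[la st] _; rewrite rowK enum_rankK.
  rewrite -(sig_big_dep (fun _ => true) (fun _ _ => true) F) linear_sum.
  apply: eq_bigr => la _; rewrite [coord y la]matrix_sum_delta pair_big /=.
  rewrite [tab_inv _]linear_sum [mxvec _]linear_sum.
  by apply: eq_bigr => -[s t] _; rewrite /= !linearZ /= mxE.
have coord0 (y : 'rV_#|{: J}|) : y *m E = 0 -> y = 0.
  rewrite yE => /(canRL mxvecK); rewrite linear0 => sum0.
  apply/rowP => i; have /matrixP/(_ (tagged (enum_val i)).1 (tagged (enum_val i)).2) :=
    sum_tab_inv_inj (tag (enum_val i)) sum0.
  by rewrite !mxE -surjective_pairing taggedK enum_valK.
have sub_ED : (E <= D)%MS.
  by apply/row_subP => j; rewrite rowK; apply/inv_sub_D/conj_sum_invariant.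
have sub_DE : (D <= E)%MS.
  rewrite -(geq_leqif (mxrank_leqif_sup sub_ED)).
  have /eqP -> : row_free E by exact: inj_row_free.
  exact: rank_leq_row.
have /submxP[y] := submx_trans (inv_sub_D A invA) sub_DE.
by rewrite yE => /(can_inj mxvecK) ->; exists (coord y).
Qed.

End InvariantMatrices.

(** * Block diagonalization *)

Section BlockDiagonalization.

Variables (C : numClosedFieldType) (n p : nat).
Variable L : forall la : partition_of n p, 'M[C]_#|ssyt la|.
Hypothesis L_cholesky :
  forall la : partition_of n p, cholesky_factor (invmx (tab_gram la C)) (L la).
Local Notation N := #|word n p|.
Local Notation B la := (tab_basis la C).
Implicit Types (la : partition_of n p) (A : invariant_alg C n p).

Lemma tab_formE la (A : 'M[C]_N) : tab_form la A = (B la)^T *m A *m B la.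
Proof.
apply/matrixP => i j; rewrite -tab_basis_adj -mulmxA mxE /inner mxE [RHS]mxE.
apply: eq_bigr => k _; congr (_ * _); first by rewrite !mxE.
by rewrite mxE [RHS]mxE; apply: eq_bigr => l _; rewrite [in RHS]mxE.
Qed.

Lemma chol_gram la : (L la)^T *m tab_gram la C *m L la = 1%:M.
Proof.
have [_ _ LL] := L_cholesky la; rewrite -mulmxA; apply: mulmx1C.
by rewrite -mulmxA -LL mulmxV ?tab_gram_unit.
Qed.

Lemma chol_conj la : map_mx Num.conj (L la) = L la.
Proof.
have [/mxOverP L_real _ _] := L_cholesky la.
by apply/matrixP => i j; rewrite mxE; apply/CrealP/L_real.
Qed.

Lemma chol_inv la : L la *m ((L la)^T *m tab_gram la C) = 1%:M.
Proof. exact/mulmx1C/chol_gram. Qed.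

Lemma chol_invK la m (X : 'M_(_, m)) :
  L la *m ((L la)^T *m ((B la)^T *m (B la *m X))) = X.
Proof.
by rewrite (mulmxA (B la)^T) (mulmxA (L la)^T) (mulmxA (L la)) chol_inv mul1mx.
Qed.

Lemma block_diagE A la :
  block_diag_map L A la = (L la)^T *m (B la)^T *m (A : 'M[C]_N) *m (B la *m L la).
Proof. by rewrite ffunE tab_formE !mulmxA. Qed.

Lemma block_diag_linear : linear (block_diag_map L).
Proof.
move=> c A A'; apply/ffunP => la; rewrite block_diagE !ffunE !tab_formE.
rewrite (_ : inv_mx (c *: A + A') = c *: inv_mx A + inv_mx A') //.
rewrite mulmxDr mulmxDl -scalemxAr -scalemxAl !mulmxA.
by [].
Qed.

(** Invariant matrices preserve the span of the columns of [B la], of which the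
    columns of [B la *m L la] form an orthonormal basis. *)
Lemma block_diag_mul : {morph block_diag_map L : A A' / A * A' >-> A * A'}.
Proof.
move=> A A'; apply/ffunP => la; rewrite [RHS]ffunE !block_diagE.
have [Y defA'] := tab_inv_span (inv_mxP A').
have [K _ KP] := tab_inv_diag C la.
have A'B : (A' : 'M[C]_N) *m B la = B la *m (Y la *m K).
  by rewrite defA' sum_tab_inv_basis KP mulmxA.
have -> : (L la)^T *m (B la)^T *m A' *m (B la *m L la) =
   (L la)^T *m tab_gram la C *m (Y la *m K *m L la).
  by rewrite -!mulmxA (mulmxA (A' : 'M_N)) A'B !mulmxA.
rewrite -[LHS]mulmxA.
have -> : ((A * A' : invariant_alg C n p) : 'M[C]_N) *m (B la *m L la) =
    (A : 'M[C]_N) *m (B la *m (Y la *m K *m L la)).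
  rewrite (_ : inv_mx (A * A') = inv_mx A *m inv_mx A') //.
  by rewrite -mulmxA (mulmxA (A' : 'M_N)) A'B !mulmxA.
by rewrite -!mulmxA chol_invK.
Qed.

Lemma block_diag_adj : {morph block_diag_map L : A / inv_adj A >-> mx_sum_adj A}.
Proof.
move=> A; apply/ffunP => la; rewrite [RHS]ffunE !block_diagE.
rewrite !adj_mulmx !trmxK tab_basis_adj chol_conj tab_basis_conj.
by rewrite real_adjmx ?chol_conj // !mulmxA.
Qed.

Lemma block_diag_bij : bijective (block_diag_map L).
Proof.
have [K K_unit KP] := fin_all_exists2 (fun la => tab_inv_diag C la).
(* The image of sum tab_inv (Y la) has the blocks L^T G Y K L, and L^T G is the
   inverse of L. *)
pose coord (Z : mx_sum C (fun la : partition_of n p => #|ssyt la|)) la : 'M_#|ssyt la| :=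
  L la *m Z la *m ((L la)^T *m tab_gram la C) *m invmx (K la).
have inv_sum (Y : forall la, 'M[C]_#|ssyt la|) :
    \sum_la tab_inv (Y la) \in @Sn_invariant C n p.
  by apply: rpred_sum => la _; apply: conj_sum_invariant.
have block_sum A Y la : (A : 'M[C]_N) = \sum_la tab_inv (Y la) ->
    block_diag_map L A la = (L la)^T *m tab_gram la C *m Y la *m K la *m L la.
  move=> defA; rewrite block_diagE defA -!mulmxA (mulmxA (\sum_la _)) sum_tab_inv_basis KP.
  by rewrite !mulmxA.
exists (fun Z => InvariantAlg (inv_sum (coord Z))) => [A|Z].
  apply: val_inj => /=; have [Y defA] := tab_inv_span (inv_mxP A).
  rewrite [RHS]defA; apply: eq_bigr => la _; congr tab_inv.
  by rewrite /coord (block_sum _ _ _ defA) -!mulmxA !chol_invK mulmxV // mulmx1.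
apply/ffunP => la; rewrite (block_sum _ (coord Z)) // /coord -!mulmxA mulKmx //.
rewrite (mulmxA (B la)^T) (mulmxA (L la)^T) (mulmxA _ (L la)) chol_gram mul1mx.
by rewrite (mulmxA (B la)^T) (mulmxA (L la)^T) chol_gram mulmx1.
Qed.

End BlockDiagonalization.

Theorem theorem6 (R : realType) (n p : nat) (n_gt0 : (0 < n)%N) (p_gt0 : (0 < p)%N)
    (L : forall la : partition_of n p, 'M[R[i]]_#|ssyt la|)
    (L_cholesky : forall la : partition_of n p,
       cholesky_factor (invmx (tab_gram la R[i])) (L la)) :
  [/\ linear (block_diag_map L),
      bijective (block_diag_map L),
      {morph block_diag_map L : A B / A * B >-> A * B}
    & {morph block_diag_map L : A / inv_adj A >-> mx_sum_adj A}].
Proof.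
split.
- exact: block_diag_linear.
- exact: block_diag_bij.
- exact: block_diag_mul.
- exact: block_diag_adj.
Qed.
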